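(* Let $\gamma:\mathbb{R}\to\mathbb{R}^4$ be a Lagrangian curve parameterized by symplectic arc-length (so $\kappa_1=0$, $\kappa_2=1$) with constant symplectic curvatures $\kappa_3,\kappa_4$. Then $\gamma$ is closed (i.e. periodic) if and only if $\kappa_3>0$, $\kappa_3^2>\kappa_4>\frac34\kappa_3^2$ and there exist positive integers $m,n$ such that $$\frac{\kappa_3^2}{(m^2+n^2)^2}=\frac{\kappa_4}{m^4+m^2n^2+n^4}.$$ In this case, taking $m>n$ relatively prime, $\gamma$ is a torus knot of type $(m,n)$: up to an affine symplectic transformation, its trajectory is a simple closed curve on a torus $\{x\in\mathbb{R}^4: x_1^2+x_3^2=r_1^2,\ x_2^2+x_4^2=r_2^2\}$ ($r_1,r_2>0$) winding, up to orientation, $n$ times around the circle factor in the $(x_1,x_3)$-plane and $m$ times around the circle factor in the $(x_2,x_4)$-plane. Moreover the symplectic length of $\gamma$ (its minimal period in the symplectic arc-length parameter) is $$\frac{2\pi}{\nu\, m}\,\mathrm{lcm}(m,n)=\frac{2\pi n}{\nu},\qquad \nu=\sqrt{\frac{\kappa_3-\sqrt{4\kappa_4-3\kappa_3^2}}{2}}.$$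
   Context: On $\mathbb{R}^4$ let $\Lambda(X,Y)=x_1y_3+x_2y_4-x_3y_1-x_4y_2$. A smooth curve $\gamma$ is Lagrangian if $\gamma',\gamma''$ are linearly independent and $\Lambda(\gamma',\gamma'')=0$ at every point. The symplectic curvatures of a parameterized curve are $\kappa_i=\Lambda(\gamma^{(i)},\gamma^{(i+1)})$, $i\ge1$. A Lagrangian curve is parameterized by symplectic arc-length if $\kappa_2=\Lambda(\gamma'',\gamma''')\equiv1$. Affine symplectic transformations are the maps $x\mapsto Ax+a$ with $a\in\mathbb{R}^4$ and $A\in\mathrm{Sp}(4,\mathbb{R})$, the linear group preserving $\Lambda$. *)

(* Defs.v *)
From mathcomp Require Import all_boot all_order all_algebra.
From mathcomp Require Import all_classical all_reals all_analysis.

Set Implicit Arguments.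
Unset Strict Implicit.
Unset Printing Implicit Defensive.

Import Order.TTheory GRing.Theory Num.Theory.
Import numFieldNormedType.Exports.

Local Open Scope classical_set_scope.
Local Open Scope ring_scope.

(* Coordinates are numbered from 0: the mathematical x_1, x_2, x_3, x_4 are
   x 0 0, x 1 0, x 2 0, x 3 0. *)
Definition xcoord (R : realType) (i : 'I_4) (x : 'cV[R]_4) : R := x i 0.

Definition Lambda (R : realType) (X Y : 'cV[R]_4) : R :=
  xcoord 0 X * xcoord 2 Y + xcoord 1 X * xcoord 3 Y
  - xcoord 2 X * xcoord 0 Y - xcoord 3 X * xcoord 1 Y.

(* Invertibility of A is automatic, since Lambda is nondegenerate. *)
Definition symplectic (R : realType) (A : 'M[R]_4) : Prop :=
  forall X Y : 'cV[R]_4, Lambda (A *m X) (A *m Y) = Lambda X Y.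

Definition smooth_curve (R : realType) (gamma : R -> 'cV[R]_4) : Prop :=
  forall (n : nat) (t : R), derivable (derive1n n gamma) t 1.

Definition lagrangian (R : realType) (gamma : R -> 'cV[R]_4) : Prop :=
  smooth_curve gamma /\
  forall t : R, free [:: derive1n 1 gamma t; derive1n 2 gamma t] /\
                Lambda (derive1n 1 gamma t) (derive1n 2 gamma t) = 0.

Definition symplectic_curvature (R : realType) (gamma : R -> 'cV[R]_4)
    (i : nat) (t : R) : R :=
  Lambda (derive1n i gamma t) (derive1n i.+1 gamma t).

Definition symplectic_arc_length (R : realType) (gamma : R -> 'cV[R]_4) : Prop :=
  forall t : R, symplectic_curvature gamma 2 t = 1.

Definition is_period (R : realType) (gamma : R -> 'cV[R]_4) (L : R) : Prop :=
  0 < L /\ forall t : R, gamma (t + L) = gamma t.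

Definition closed_curve (R : realType) (gamma : R -> 'cV[R]_4) : Prop :=
  exists L : R, is_period gamma L.

Definition minimal_period (R : realType) (gamma : R -> 'cV[R]_4) (L : R) : Prop :=
  is_period gamma L /\ forall L' : R, is_period gamma L' -> L <= L'.

(* The L-periodic curve traces a simple closed curve, exactly once per period. *)
Definition simple_closed (R : realType) (gamma : R -> 'cV[R]_4) (L : R) : Prop :=
  is_period gamma L /\
  forall s t : R, 0 <= s < L -> 0 <= t < L -> gamma s = gamma t -> s = t.

Definition torus (R : realType) (r1 r2 : R) : set 'cV[R]_4 :=
  [set x | xcoord 0 x ^+ 2 + xcoord 2 x ^+ 2 = r1 ^+ 2 /\
           xcoord 1 x ^+ 2 + xcoord 3 x ^+ 2 = r2 ^+ 2].

(* The L-periodic planar curve (x, y), lying on the circle of radius r > 0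
   centered at the origin, has winding number w: a continuous determination
   theta of its angle increases by 2 pi w over one period. *)
Definition winding (R : realType) (x y : R -> R) (r L : R) (w : int) : Prop :=
  exists theta : R -> R,
    [/\ continuous theta,
        forall t : R, x t = r * cos (theta t) /\ y t = r * sin (theta t) &
        theta L - theta 0 = 2 * pi * w%:~R].

(* The windings are prescribed only up to sign, independently on each circle. *)
Definition torus_knot (R : realType) (m n : nat) (gamma : R -> 'cV[R]_4) : Prop :=
  exists (A : 'M[R]_4) (a : 'cV[R]_4) (r1 r2 L : R) (w1 w2 : int),
    let eta := fun t : R => A *m gamma t + a in
    [/\ symplectic A,
        0 < r1 /\ 0 < r2,
        (forall t : R, torus r1 r2 (eta t)) /\ simple_closed eta L,
        `|w1|%N = n /\ winding (xcoord 0 \o eta) (xcoord 2 \o eta) r1 L w1 &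
        `|w2|%N = m /\ winding (xcoord 1 \o eta) (xcoord 3 \o eta) r2 L w2].

Definition curvature_ratio (R : realType) (k3 k4 : R) (m n : nat) : Prop :=
  k3 ^+ 2 / (m%:R ^+ 2 + n%:R ^+ 2) ^+ 2
  = k4 / (m%:R ^+ 4 + m%:R ^+ 2 * n%:R ^+ 2 + n%:R ^+ 4).

(* Main.v *)
Require Import Defs.
From mathcomp Require Import all_boot all_order all_algebra.
From mathcomp Require Import all_classical all_reals all_analysis.
From mathcomp Require Import ring lra.

Set Implicit Arguments.
Unset Strict Implicit.
Unset Printing Implicit Defensive.

Import Order.TTheory GRing.Theory Num.Theory.
Import numFieldNormedType.Exports.

Local Open Scope classical_set_scope.
Local Open Scope ring_scope.

(** Write g_i for the i-th derivative of gamma. Differentiating the constants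
    Lambda(g_1, g_2) = 0, Lambda(g_2, g_3) = 1, ... determines every
    Lambda(g_i, g_j) with 1 <= i, j <= 5. In particular
    (g_4 + k3 g_2, g_2, g_1, g_3) is a symplectic basis of R^4, and expressing
    g_5 in it gives the linear equation with constant coefficients
      g_5 + k3 g_3 + (k3^2 - k4) g_1 = 0                        (curve_ode).
    Its characteristic polynomial in s, the square of the exponent, is
    s^2 + k3 s + (k3^2 - k4), of discriminant 4 k4 - 3 k3^2.

    Suppose that gamma is periodic. A periodic function whose derivative has
    constant sign has zero derivative (periodic_ndecr_derive0). Applied to
    suitable quadratic expressions in the coordinates of the g_i, this excludes
    a discriminant <= 0 (periodic_discriminant) and a root s >= 0
    (periodic_root_lt0), since g_1, ..., g_4 are linearly independent. So the
    roots are -mu^2 < -nu^2 < 0, that is k3 = mu^2 + nu^2 and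
    k4 = mu^4 + mu^2 nu^2 + nu^4.

    Conversely, for such k3 and k4 the vectors g_4 + mu^2 g_2 and g_4 + nu^2 g_2
    are harmonic oscillations of pulsations nu and mu, and gamma is a constant
    plus a linear combination of the two. The planes in which they move are
    symplectically orthogonal, so after rescaling their initial data form a
    symplectic basis, in which gamma becomes
      (r1 cos nu t, r2 cos mu t, - r1 sin nu t, r2 sin mu t)
    (torus_normal_form). Hence gamma s = gamma t exactly when nu (s - t) and
    mu (s - t) are both multiples of 2 pi (torus_curve_eq). So gamma is periodic
    if and only if mu : nu = m : n for positive integers m and n, which is what
    the ratio condition on k3 and k4 says (frequencies_ratio,
    ratio_frequencies). With mu = om m, nu = om n and m, n coprime, the minimal
    period is 2 pi / om, over which the two angles make n and m turns. *)

(** * Linear symplectic algebra *)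

Lemma sum_ord4 (V : nmodType) (f : 'I_4 -> V) :
  \sum_(i < 4) f i = f 0 + f 1 + f 2 + f 3.
Proof.
rewrite !big_ord_recl big_ord0 addr0 !addrA.
by congr (f _ + f _ + f _ + f _); apply: val_inj.
Qed.

Lemma forall_ord4 (P : 'I_4 -> Prop) : P 0 -> P 1 -> P 2 -> P 3 -> forall i, P i.
Proof.
move=> P0 P1 P2 P3 [[|[|[|[|//]]]] lti].
- by rewrite (_ : Ordinal lti = 0) //; apply: val_inj.
- by rewrite (_ : Ordinal lti = 1) //; apply: val_inj.
- by rewrite (_ : Ordinal lti = 2) //; apply: val_inj.
- by rewrite (_ : Ordinal lti = 3) //; apply: val_inj.
Qed.

Section Lambda.
Variable R : realType.
Implicit Types (X Y Z : 'cV[R]_4) (A : 'M[R]_4) (k : R).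

Lemma LambdaDl X Y Z : Lambda (X + Y) Z = Lambda X Z + Lambda Y Z.
Proof. by rewrite /Lambda /xcoord !mxE; ring. Qed.

Lemma LambdaZl k X Y : Lambda (k *: X) Y = k * Lambda X Y.
Proof. by rewrite /Lambda /xcoord !mxE; ring. Qed.

Lemma LambdaC X Y : Lambda X Y = - Lambda Y X.
Proof. by rewrite /Lambda /xcoord; ring. Qed.

Lemma LambdaDr X Y Z : Lambda X (Y + Z) = Lambda X Y + Lambda X Z.
Proof. by rewrite /Lambda /xcoord !mxE; ring. Qed.

Lemma LambdaZr k X Y : Lambda X (k *: Y) = k * Lambda X Y.
Proof. by rewrite /Lambda /xcoord !mxE; ring. Qed.

Lemma Lambdaxx X : Lambda X X = 0.
Proof. by rewrite /Lambda /xcoord; ring. Qed.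

Lemma Lambda0r X : Lambda X 0 = 0.
Proof. by rewrite -(scale0r 0) LambdaZr mul0r. Qed.

Lemma Lambda_nondegenerate X : (forall Y, Lambda Y X = 0) -> X = 0.
Proof.
move=> X0; apply/matrixP => i j; rewrite [j]ord1 [RHS]mxE; move: i.
have E i := X0 (delta_mx i 0).
apply: forall_ord4; [have := E 2|have := E 3|have := E 0|have := E 1];
  rewrite /Lambda /xcoord !mxE /= ?(mul0r, mul1r, add0r, addr0, subr0, sub0r);
  lra.
Qed.

Lemma symplectic_unitmx A : symplectic A -> A \in unitmx.
Proof.
move=> sA; rewrite -unitmx_tr -row_free_unit; apply: inj_row_free => v vA0.
have Av0 : A *m v^T = 0 by apply: trmx_inj; rewrite trmx_mul trmxK vA0 trmx0.
apply: trmx_inj; rewrite trmx0; apply: Lambda_nondegenerate => Y.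
by rewrite -sA Av0 Lambda0r.
Qed.

Lemma symplectic_invmx A : symplectic A -> symplectic (invmx A).
Proof.
by move=> sA X Y; rewrite -sA !mulKVmx // symplectic_unitmx.
Qed.

Definition frame_mx (e : seq 'cV[R]_4) : 'M[R]_4 := \matrix_(i, j) e`_j i 0.

Lemma frame_mxE e0 e1 e2 e3 X :
  frame_mx [:: e0; e1; e2; e3] *m X =
  X 0 0 *: e0 + X 1 0 *: e1 + X 2 0 *: e2 + X 3 0 *: e3.
Proof.
apply/matrixP => i j; rewrite [j]ord1 !mxE sum_ord4 !mxE /=.
by rewrite ![_ * X _ _]mulrC.
Qed.

(** A frame with the products of the standard symplectic basis is the image of
    that basis under a symplectic matrix; this is how symplectic matrices are
    produced below. *)
Lemma symplectic_frame e0 e1 e2 e3 :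
  Lambda e0 e2 = 1 -> Lambda e1 e3 = 1 ->
  Lambda e0 e1 = 0 -> Lambda e0 e3 = 0 -> Lambda e2 e1 = 0 -> Lambda e2 e3 = 0 ->
  symplectic (frame_mx [:: e0; e1; e2; e3]).
Proof.
move=> e02 e13 e01 e03 e21 e23 X Y.
have [e20 e31] : Lambda e2 e0 = -1 /\ Lambda e3 e1 = -1.
  by rewrite LambdaC e02 LambdaC e13.
have [e10 e30 e12 e32] : [/\ Lambda e1 e0 = 0, Lambda e3 e0 = 0,
    Lambda e1 e2 = 0 & Lambda e3 e2 = 0].
  by split; rewrite LambdaC ?e01 ?e03 ?e21 ?e23 oppr0.
rewrite !frame_mxE !(LambdaDl, LambdaDr, LambdaZl, LambdaZr) !Lambdaxx.
rewrite e02 e13 e01 e03 e21 e23 e20 e31 e10 e30 e12 e32 /Lambda /xcoord; ring.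
Qed.

Lemma Lambda_frame_eq0 e0 e1 e2 e3 v : symplectic (frame_mx [:: e0; e1; e2; e3]) ->
  Lambda e0 v = 0 -> Lambda e1 v = 0 -> Lambda e2 v = 0 -> Lambda e3 v = 0 ->
  v = 0.
Proof.
move=> /symplectic_unitmx uM v0 v1 v2 v3; apply: Lambda_nondegenerate => Y.
rewrite -(mulKVmx uM Y) frame_mxE !(LambdaDl, LambdaZl) v0 v1 v2 v3.
by rewrite !mulr0 !addr0.
Qed.

End Lambda.

(** * Periodic solutions of linear differential equations *)

Section Calculus.
Variable R : realType.
Implicit Types (h dh v w : R -> R) (t : R).

Lemma ndecr_is_derive h dh : (forall t, is_derive t (1 : R) h (dh t)) ->
  (forall t, 0 <= dh t) -> {homo h : s t / s <= t}.
Proof.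
move=> hh dh0 s t st; have [|c _ E] := MVT_segment st (fun x _ => hh x).
  apply/continuous_subspaceT => x.
  exact/differentiable_continuous/derivable1_diffP.
by rewrite -subr_ge0 E mulr_ge0 ?subr_ge0.
Qed.

(** The engine of every non-periodicity argument: between x and a later
    translate y + n L of y, monotonicity gives h x <= h y for all x and y. *)
Lemma periodic_ndecr_derive0 h dh (L : R) : 0 < L -> periodic h L ->
  (forall t, is_derive t (1 : R) h (dh t)) -> (forall t, 0 <= dh t) ->
  forall t, dh t = 0.
Proof.
move=> L0 hL hh dh0 t; have hndecr := ndecr_is_derive hh dh0.
suff hcst s : h s = h 0.
  have := hh t; rewrite (_ : h = cst (h 0)); last by apply/funext.
  by move=> /(@derive_val _ _ _ _ _ _ _) <-; rewrite derive_cst.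
have le x y : h x <= h y.
  have [n] : exists n, x <= y + L *+ n.
    exists (Num.truncn (`|x - y| / L)).+1.
    rewrite -lerBlDl (le_trans (ler_norm _)) // -[leLHS](@divfK _ L) ?gt_eqF //.
    by rewrite -[leRHS]mulr_natl ler_pM2r // ltW // truncnS_gt.
  by move=> /hndecr; rewrite periodicn.
by apply/eqP; rewrite eq_le !le.
Qed.

(** For w'' = s w with s >= 0, the function w w' has the nonnegative derivative
    w'^2 + s w^2. *)
Lemma periodic_hyperbolic (s L : R) w v : 0 <= s -> 0 < L -> periodic w L ->
  periodic v L -> (forall t, is_derive t (1 : R) w (v t)) ->
  (forall t, is_derive t (1 : R) v (s * w t)) -> forall t, v t = 0.
Proof.
move=> s0 L0 wL vL dw dv t.
have wvL : periodic (w * v) L by move=> u; rewrite !fctE wL vL.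
have dwv u : is_derive u (1 : R) (w * v) (v u ^+ 2 + s * w u ^+ 2).
  by apply: is_derive_eq; rewrite ![_ *: _]mulrC; ring.
have /= := periodic_ndecr_derive0 L0 wvL dwv _ t.
have sw_ge0 u : 0 <= s * w u ^+ 2 by rewrite mulr_ge0 ?sqr_ge0.
move=> /(_ (fun u => addr_ge0 (sqr_ge0 (v u)) (sw_ge0 u)))/eqP.
by rewrite paddr_eq0 ?sqr_ge0 // sqrf_eq0 => /andP[/eqP].
Qed.

(** For y'''' + k y'' + c y = 0, the derivative of y' y'' - y y''' is
    y''^2 + k y y'' + c y^2, a quadratic form in (y, y'') which is positive
    semidefinite when k^2 <= 4 c. The equality case k^2 = 4 c, that of resonant
    solutions with unbounded amplitude, is included because the square of
    y'' + (k / 2) y vanishes in both cases. *)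
Lemma periodic_elliptic (k c L : R) (y0 y1 y2 y3 : R -> R) :
  k ^+ 2 <= 4 * c -> 0 < L ->
  periodic y0 L -> periodic y1 L -> periodic y2 L -> periodic y3 L ->
  (forall t, is_derive t (1 : R) y0 (y1 t)) ->
  (forall t, is_derive t (1 : R) y1 (y2 t)) ->
  (forall t, is_derive t (1 : R) y2 (y3 t)) ->
  (forall t, is_derive t (1 : R) y3 (- k * y2 t - c * y0 t)) ->
  forall t, y2 t + k / 2 * y0 t = 0.
Proof.
move=> kc L0 p0 p1 p2 p3 d0 d1 d2 d3 t.
have hL : periodic (y1 * y2 - y0 * y3) L.
  by move=> u; rewrite !fctE p0 p1 p2 p3.
have dh u : is_derive u (1 : R) (y1 * y2 - y0 * y3)
    ((y2 u + k / 2 * y0 u) ^+ 2 + (c - k ^+ 2 / 4) * y0 u ^+ 2).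
  by apply: is_derive_eq; rewrite ![_ *: _]mulrC; field.
have /= := periodic_ndecr_derive0 L0 hL dh _ t.
have cy_ge0 u : 0 <= (c - k ^+ 2 / 4) * y0 u ^+ 2.
  by rewrite mulr_ge0 ?sqr_ge0 //; lra.
move=> /(_ (fun u => addr_ge0 (sqr_ge0 _) (cy_ge0 u)))/eqP.
by rewrite paddr_eq0 ?sqr_ge0 // sqrf_eq0 => /andP[/eqP].
Qed.

(** Rotating the pair (om w, v) back by the angle om t makes it constant. *)
Lemma oscillator (om : R) w v : om != 0 ->
  (forall t, is_derive t (1 : R) w (v t)) ->
  (forall t, is_derive t (1 : R) v (- om ^+ 2 * w t)) ->
  forall t, w t = w 0 * cos (om * t) + v 0 / om * sin (om * t).
Proof.
move=> om0 dw dv t.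
have dl (x : R) : is_derive x (1 : R) ( *%R om) om.
  by rewrite -[X in is_derive _ _ _ X]mulr1; exact: (@is_deriveZ _ _ _ id).
pose C := cos \o *%R om; pose S := sin \o *%R om.
have dC (x : R) : is_derive x (1 : R) C (- sin (om * x) * om).
  exact: is_derive1_comp.
have dS (x : R) : is_derive x (1 : R) S (cos (om * x) * om).
  exact: is_derive1_comp.
have pE (x : R) : is_derive x (1 : R) (om \*: w * C - v * S) 0.
  apply: is_derive_eq; rewrite /C /S /=.
  by move: (w x) (v x) (cos _) (sin _) => *; rewrite ![_ *: _]mulrC; ring.
have qE (x : R) : is_derive x (1 : R) (om \*: w * S + v * C) 0.
  apply: is_derive_eq; rewrite /C /S /=.
  by move: (w x) (v x) (cos _) (sin _) => *; rewrite ![_ *: _]mulrC; ring.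
have := is_derive_0_is_cst t 0 pE; have := is_derive_0_is_cst t 0 qE.
rewrite /C /S !fctE /= mulr0 cos0 sin0 !mulr0 !mulr1 subr0 add0r.
set c := cos _; set s := sin _; rewrite ![_ *: _]mulrC => qt pt.
apply: (mulIf om0); rewrite mulrDl mulrAC -pt -qt.
rewrite -[LHS]mulr1 -(cos2Dsin2 (om * t)) -/c -/s; field.
exact: om0.
Qed.

End Calculus.

(** * Derivatives of curves in R^4 *)

Section Derivatives.
Variable R : realType.
Implicit Types (X Y gamma : R -> 'cV[R]_4) (t L : R) (n : nat).

Lemma is_derive_coord X (X' : 'cV[R]_4) t i : is_derive t (1 : R) X X' ->
  is_derive t (1 : R) (fun s => X s i 0) (X' i 0).
Proof.
move=> [dX <-]; apply: DeriveDef; first by move/derivable_mxP: dX; apply.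
by rewrite derive_mx // mxE.
Qed.

Lemma is_derive_Lambda X Y (X' Y' : 'cV[R]_4) t :
  is_derive t (1 : R) X X' -> is_derive t (1 : R) Y Y' ->
  is_derive t (1 : R) (fun s => Lambda (X s) (Y s))
    (Lambda X' (Y t) + Lambda (X t) Y').
Proof.
move=> dX dY.
have dM i j : is_derive t (1 : R) (fun s => X s i 0 * Y s j 0)
    (X' i 0 * Y t j 0 + X t i 0 * Y' j 0).
  have dXY := is_deriveM (is_derive_coord i dX) (is_derive_coord j dY).
  by apply: (is_derive_eq dXY); rewrite addrC [_ *: X' i 0]mulrC.
have dL := is_deriveB (is_deriveB (is_deriveD (dM 0 2) (dM 1 3)) (dM 2 0)) (dM 3 1).
by apply: (is_derive_eq dL); rewrite /Lambda /xcoord; ring.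
Qed.

Lemma is_derive_derive1n gamma n t : smooth_curve gamma ->
  is_derive t (1 : R) (derive1n n gamma) (derive1n n.+1 gamma t).
Proof. by move=> /(_ n t)/derivableP; rewrite derive1nS derive1E. Qed.

Lemma periodic_derive1n gamma L n :
  periodic gamma L -> periodic (derive1n n gamma) L.
Proof.
move=> gL; elim: n => [//|n IHn] t; rewrite derive1nS /derive1.
suff -> : (fun h => h^-1 *: (derive1n n gamma (h + (t + L))
                             - derive1n n gamma (t + L)))
        = (fun h => h^-1 *: (derive1n n gamma (h + t) - derive1n n gamma t)).
  by [].
by apply/funext => h; rewrite addrA !IHn.
Qed.

End Derivatives.

(** * Curves with constant symplectic curvatures *)

(** The minus sign makes the (x_1, x_3)-circle run clockwise: the two oscillation
    planes of a curve have opposite symplectic orientations. *)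
Definition torus_point (R : realType) (r1 r2 x y : R) : 'cV[R]_4 :=
  \col_i [:: r1 * cos x; r2 * cos y; - (r1 * sin x); r2 * sin y]`_i.

(** The curve is represented by the family of its derivatives, gamma = g 0, so
    that comparing two of them compares only their orders. *)
Section Curve.
Variables (R : realType) (g : nat -> R -> 'cV[R]_4) (k3 k4 : R).
Hypothesis dg : forall n t, is_derive t (1 : R) (g n) (g n.+1 t).
Hypothesis Lambda12 : forall t, Lambda (g 1 t) (g 2 t) = 0.
Hypothesis Lambda23 : forall t, Lambda (g 2 t) (g 3 t) = 1.
Hypothesis Lambda34 : forall t, Lambda (g 3 t) (g 4 t) = k3.
Hypothesis Lambda45 : forall t, Lambda (g 4 t) (g 5 t) = k4.

(* The product rule: each constant Lambda(g_i, g_j) yields a new product. *)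
Let gram_shift i j c : (forall t, Lambda (g i t) (g j t) = c) ->
  forall t, Lambda (g i t) (g j.+1 t) = - Lambda (g i.+1 t) (g j t).
Proof.
move=> gc t; apply/eqP; rewrite -addr_eq0 addrC; apply/eqP.
have [_] := is_derive_Lambda (dg i t) (dg j t).
rewrite (_ : (fun s => _) = cst c); last by apply/funext.
by rewrite derive_cst.
Qed.

Let Lambda13 t : Lambda (g 1 t) (g 3 t) = 0.
Proof. by rewrite (gram_shift Lambda12) Lambdaxx oppr0. Qed.

Let Lambda14 t : Lambda (g 1 t) (g 4 t) = -1.
Proof. by rewrite (gram_shift Lambda13) Lambda23. Qed.

Let Lambda24 t : Lambda (g 2 t) (g 4 t) = 0.
Proof. by rewrite (gram_shift Lambda23) Lambdaxx oppr0. Qed.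

Let Lambda15 t : Lambda (g 1 t) (g 5 t) = 0.
Proof. by rewrite (gram_shift Lambda14) Lambda24 oppr0. Qed.

Let Lambda25 t : Lambda (g 2 t) (g 5 t) = - k3.
Proof. by rewrite (gram_shift Lambda24) Lambda34. Qed.

Let Lambda35 t : Lambda (g 3 t) (g 5 t) = 0.
Proof. by rewrite (gram_shift Lambda34) Lambdaxx oppr0. Qed.

Let LambdaE :=
  (Lambda12, Lambda13, Lambda14, Lambda15, Lambda23, Lambda24, Lambda25,
   Lambda34, Lambda35, Lambda45,
   LambdaDl, LambdaDr, LambdaZl, LambdaZr, Lambdaxx).

Lemma curve_ode t :
  g 5 t + k3 *: g 3 t + (k3 ^+ 2 - k4) *: g 1 t = 0.
Proof.
have E21 : Lambda (g 2 t) (g 1 t) = 0 by rewrite LambdaC Lambda12 oppr0.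
have E31 : Lambda (g 3 t) (g 1 t) = 0 by rewrite LambdaC Lambda13 oppr0.
have E32 : Lambda (g 3 t) (g 2 t) = -1 by rewrite LambdaC Lambda23.
have E41 : Lambda (g 4 t) (g 1 t) = 1 by rewrite LambdaC Lambda14 opprK.
have E42 : Lambda (g 4 t) (g 2 t) = 0 by rewrite LambdaC Lambda24 oppr0.
have E43 : Lambda (g 4 t) (g 3 t) = -k3 by rewrite LambdaC Lambda34.
(* Adding k3 g_2 to g_4 makes it orthogonal to g_3. *)
have : symplectic (frame_mx [:: g 4 t + k3 *: g 2 t; g 2 t; g 1 t; g 3 t]).
  by apply: symplectic_frame; rewrite !LambdaE ?E21 ?E31 ?E32 ?E41 ?E42 ?E43;
    ring.
by move=> /Lambda_frame_eq0; apply;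
  rewrite !LambdaE ?E21 ?E31 ?E32 ?E41 ?E42 ?E43; ring.
Qed.

Let g5E t : g 5 t = - k3 *: g 3 t - (k3 ^+ 2 - k4) *: g 1 t.
Proof.
apply/eqP; rewrite -subr_eq0 -(curve_ode t) scaleNr opprB opprK.
by rewrite [_ + k3 *: _]addrC addrA.
Qed.

(** A discriminant <= 0 would force g_3 + (k3 / 2) g_1 = 0 by
    [periodic_elliptic], against Lambda(g_2, g_3) = 1. *)
Lemma periodic_discriminant (L : R) : 0 < L -> (forall n, periodic (g n) L) ->
  0 < 4 * k4 - 3 * k3 ^+ 2.
Proof.
move=> L0 gL; rewrite ltNge; apply/negP => D0.
suff E : g 3 0 + (k3 / 2) *: g 1 0 = 0.
  have := Lambda0r (g 2 0); rewrite -E !LambdaE LambdaC Lambda12 => /eqP.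
  by rewrite oppr0 mulr0 addr0 oner_eq0.
apply/matrixP => i j; rewrite [j]ord1 !mxE.
have dc n t := is_derive_coord i (dg n t).
have pc n : periodic (fun t => g n t i 0) L by move=> t; rewrite gL.
have kc : k3 ^+ 2 <= 4 * (k3 ^+ 2 - k4) by lra.
apply: (periodic_elliptic kc L0 (pc 1) (pc 2) (pc 3) (pc 4)) => // t.
by apply: (is_derive_eq (dc 4 t)); rewrite g5E !mxE.
Qed.

(** For s and s' the two roots of the characteristic polynomial, g_3 - s' g_1
    solves w'' = s w. If s >= 0 then its derivative g_4 - s' g_2 vanishes by
    [periodic_hyperbolic], against Lambda(g_1, g_4) = -1. *)
Lemma periodic_root_lt0 (L s s' : R) : 0 < L -> (forall n, periodic (g n) L) ->
  s + s' = - k3 -> s * s' = k3 ^+ 2 - k4 -> s < 0.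
Proof.
move=> L0 gL Es Ep; rewrite ltNge; apply/negP => s0.
suff E : g 4 0 - s' *: g 2 0 = 0.
  have := Lambda0r (g 1 0); rewrite -E -scaleNr !LambdaE => /eqP.
  by rewrite mulr0 addr0 oppr_eq0 oner_eq0.
apply/matrixP => i j; rewrite [j]ord1 !mxE.
have dc n t := is_derive_coord i (dg n t).
have pc n : periodic (fun t => g n t i 0) L by move=> t; rewrite gL.
apply: (periodic_hyperbolic (w := fun t => g 3 t i 0 - s' * g 1 t i 0)
    (v := fun t => g 4 t i 0 - s' * g 2 t i 0) s0 L0) => t /=.
- by rewrite !gL.
- by rewrite !gL.
- apply: (is_derive_eq (is_deriveB (dc 4 t) (is_deriveZ s' (dc 2 t)))).
  by rewrite g5E !mxE -Ep -Es [_ *: _]mulrC; ring.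
Qed.

Lemma periodic_frequencies (L : R) : 0 < L -> (forall n, periodic (g n) L) ->
  exists mu nu : R, [/\ 0 < nu < mu, k3 = mu ^+ 2 + nu ^+ 2 &
    k4 = mu ^+ 4 + mu ^+ 2 * nu ^+ 2 + nu ^+ 4].
Proof.
move=> L0 gL; have D0 := periodic_discriminant L0 gL.
set D := 4 * k4 - 3 * k3 ^+ 2 in D0.
have d0 : 0 < Num.sqrt D by rewrite sqrtr_gt0.
have d2 : Num.sqrt D ^+ 2 = D by rewrite sqr_sqrtr // ltW.
set d := Num.sqrt D in d0 d2.
have s1 : (- k3 + d) / 2 < 0.
  by apply: (periodic_root_lt0 (s' := (- k3 - d) / 2) L0 gL); rewrite /D in d2;
    [field|nra].
have s2 : (- k3 - d) / 2 < 0 by lra.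
exists (Num.sqrt ((k3 + d) / 2)), (Num.sqrt ((k3 - d) / 2)).
have E1 : Num.sqrt ((k3 + d) / 2) ^+ 2 = (k3 + d) / 2.
  by rewrite sqr_sqrtr //; lra.
have E2 : Num.sqrt ((k3 - d) / 2) ^+ 2 = (k3 - d) / 2.
  by rewrite sqr_sqrtr //; lra.
split.
- by rewrite sqrtr_gt0 ltr_sqrt; lra.
- by rewrite E1 E2; field.
- by rewrite -![_ ^+ 4]/(_ ^+ (2 * 2)) !exprM E1 E2; rewrite /D in d2; nra.
Qed.

(** The operator D^2 + om'^2 kills the mode of pulsation om', leaving a pure
    oscillation of pulsation om. *)
Lemma mode_oscillation (om om' : R) t : om != 0 ->
  k3 = om ^+ 2 + om' ^+ 2 -> k3 ^+ 2 - k4 = om ^+ 2 * om' ^+ 2 ->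
  g 4 t + om' ^+ 2 *: g 2 t =
  cos (om * t) *: (g 4 0 + om' ^+ 2 *: g 2 0)
  - (om * sin (om * t)) *: (g 3 0 + om' ^+ 2 *: g 1 0).
Proof.
move=> om0 Es Ep; apply/matrixP => i j; rewrite [j]ord1 !mxE.
have dc n u := is_derive_coord i (dg n u).
have dw u : is_derive u (1 : R) (fun s => g 4 s i 0 + om' ^+ 2 * g 2 s i 0)
    (- om ^+ 2 * (g 3 u i 0 + om' ^+ 2 * g 1 u i 0)).
  apply: (is_derive_eq (is_deriveD (dc 4 u) (is_deriveZ (om' ^+ 2) (dc 2 u)))).
  by rewrite g5E !mxE Ep Es [_ *: _]mulrC; ring.
have dv u : is_derive u (1 : R)
    (fun s => - om ^+ 2 * (g 3 s i 0 + om' ^+ 2 * g 1 s i 0))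
    (- om ^+ 2 * (g 4 u i 0 + om' ^+ 2 * g 2 u i 0)).
  apply: (is_derive_eq (is_deriveZ (- om ^+ 2)
    (is_deriveD (dc 3 u) (is_deriveZ (om' ^+ 2) (dc 1 u))))).
  by rewrite ![_ *: _]mulrC; ring.
by rewrite (oscillator om0 dw dv); field.
Qed.

(** The curve minus its two modes is its center: the coefficients are those for
    which the derivative vanishes by the differential equation. *)
Lemma center_mode (mu nu : R) t : mu != 0 -> nu != 0 -> mu ^+ 2 != nu ^+ 2 ->
  k3 = mu ^+ 2 + nu ^+ 2 -> k3 ^+ 2 - k4 = mu ^+ 2 * nu ^+ 2 ->
  let d := mu ^+ 2 - nu ^+ 2 in
  let c u := g 0 u + (nu ^+ 2 * d)^-1 *: (g 4 u + mu ^+ 2 *: g 2 u)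
                   - (mu ^+ 2 * d)^-1 *: (g 4 u + nu ^+ 2 *: g 2 u) in
  c t = c 0.
Proof.
move=> mu0 nu0 munu Es Ep d; have d0 : d != 0 by rewrite subr_eq0.
apply/matrixP => i j; rewrite [j]ord1.
have dmode om u := is_deriveD (dg 4 u) (is_deriveZ om (dg 2 u)).
have dcenter u := is_derive_coord i (is_deriveB
  (is_deriveD (dg 0 u) (is_deriveZ (nu ^+ 2 * d)^-1 (dmode (mu ^+ 2) u)))
  (is_deriveZ (mu ^+ 2 * d)^-1 (dmode (nu ^+ 2) u))).
have center0 u : (g 1 u + (nu ^+ 2 * d)^-1 *: (g 5 u + mu ^+ 2 *: g 3 u)
    - (mu ^+ 2 * d)^-1 *: (g 5 u + nu ^+ 2 *: g 3 u)) i 0 = 0.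
  by rewrite g5E !mxE Ep Es /d; field; rewrite -/d d0 mu0.
exact: (is_derive_0_is_cst t 0
  (fun u => is_derive_eq (dcenter u) (center0 u))).
Qed.

(** The oscillation planes are spanned by (g_4 + mu^2 g_2, g_3 + mu^2 g_1) and
    (g_4 + nu^2 g_2, g_3 + nu^2 g_1) at time 0. The products of these vectors are
    mu^2 - nu^2 and nu^2 - mu^2 inside each plane, and 0 across the planes. *)
Lemma torus_normal_form (mu nu : R) : 0 < nu < mu ->
  k3 = mu ^+ 2 + nu ^+ 2 -> k4 = mu ^+ 4 + mu ^+ 2 * nu ^+ 2 + nu ^+ 4 ->
  exists (A : 'M[R]_4) (a : 'cV[R]_4) (r1 r2 : R),
    [/\ symplectic A, 0 < r1, 0 < r2 &
    forall t, A *m g 0 t + a = torus_point r1 r2 (nu * t) (mu * t)].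
Proof.
move=> /andP[nu0 numu] Es E4; have mu0 := lt_trans nu0 numu.
have Ep : k3 ^+ 2 - k4 = mu ^+ 2 * nu ^+ 2 by rewrite E4 Es; ring.
have d0 : 0 < mu ^+ 2 - nu ^+ 2 by rewrite subr_gt0 ltr_pXn2r // nnegrE ltW.
have [[mun0 nun0] dn0] := (lt0r_neq0 mu0, lt0r_neq0 nu0, lt0r_neq0 d0).
have munu : mu ^+ 2 != nu ^+ 2 by rewrite -subr_eq0.
set d := _ - _ in d0 dn0.
(* a1 and a2 are the inverse radii; these values normalize the product of the
   two axes of each plane to 1. *)
pose a1 := Num.sqrt (nu ^+ 3 * d); pose a2 := Num.sqrt (mu ^+ 3 * d).
have nu3d0 : 0 < nu ^+ 3 * d by rewrite mulr_gt0 ?exprn_gt0.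
have mu3d0 : 0 < mu ^+ 3 * d by rewrite mulr_gt0 ?exprn_gt0.
have a1_gt0 : 0 < a1 by rewrite sqrtr_gt0.
have a2_gt0 : 0 < a2 by rewrite sqrtr_gt0.
have a1sq : a1 ^+ 2 = nu ^+ 3 * d by rewrite sqr_sqrtr // ltW.
have a2sq : a2 ^+ 2 = mu ^+ 3 * d by rewrite sqr_sqrtr // ltW.
have [a1n0 a2n0] := (lt0r_neq0 a1_gt0, lt0r_neq0 a2_gt0).
pose e0 := (- (a1 / (nu ^+ 2 * d))) *: (g 4 0 + mu ^+ 2 *: g 2 0).
pose e1 := (a2 / (mu ^+ 2 * d)) *: (g 4 0 + nu ^+ 2 *: g 2 0).
pose e2 := (- (a1 / (nu * d))) *: (g 3 0 + mu ^+ 2 *: g 1 0).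
pose e3 := (- (a2 / (mu * d))) *: (g 3 0 + nu ^+ 2 *: g 1 0).
have sM : symplectic (frame_mx [:: e0; e1; e2; e3]).
  have [E41 E43 E42] : [/\ Lambda (g 4 0) (g 1 0) = 1,
      Lambda (g 4 0) (g 3 0) = - k3 & Lambda (g 4 0) (g 2 0) = 0].
    by split; rewrite LambdaC ?Lambda14 ?Lambda34 ?Lambda24 ?opprK ?oppr0.
  have [E21 E31 E32] : [/\ Lambda (g 2 0) (g 1 0) = 0,
      Lambda (g 3 0) (g 1 0) = 0 & Lambda (g 3 0) (g 2 0) = -1].
    by split; rewrite LambdaC ?Lambda12 ?Lambda13 ?Lambda23 ?oppr0.
  apply: symplectic_frame;
    rewrite !LambdaE ?E21 ?E31 ?E32 ?E41 ?E42 ?E43 ?Es; try ring.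
  - transitivity (a1 ^+ 2 / (nu ^+ 3 * d)); last by rewrite a1sq divff ?gt_eqF.
    by rewrite /d; field; rewrite -/d dn0.
  - transitivity (a2 ^+ 2 / (mu ^+ 3 * d)); last by rewrite a2sq divff ?gt_eqF.
    by rewrite /d; field; rewrite -/d dn0.
pose M := frame_mx [:: e0; e1; e2; e3].
pose c := g 0 0 + (nu ^+ 2 * d)^-1 *: (g 4 0 + mu ^+ 2 *: g 2 0)
                - (mu ^+ 2 * d)^-1 *: (g 4 0 + nu ^+ 2 *: g 2 0).
exists (invmx M), (- (invmx M *m c)), a1^-1, a2^-1.
split; rewrite ?invr_gt0 //; first exact: symplectic_invmx.
move=> t; rewrite -mulmxN -mulmxDr; apply: (canLR (mulKmx _)).
  exact: symplectic_unitmx.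
have <- : g 0 t + (nu ^+ 2 * d)^-1 *: (g 4 t + mu ^+ 2 *: g 2 t)
    - (mu ^+ 2 * d)^-1 *: (g 4 t + nu ^+ 2 *: g 2 t) = c.
  exact: (center_mode t mun0 nun0 munu Es Ep).
have Es' : k3 = nu ^+ 2 + mu ^+ 2 by rewrite Es addrC.
have Ep' : k3 ^+ 2 - k4 = nu ^+ 2 * mu ^+ 2 by rewrite Ep mulrC.
rewrite (mode_oscillation t nun0 Es' Ep') (mode_oscillation t mun0 Es Ep).
rewrite frame_mxE; apply/matrixP => i j; rewrite [j]ord1 !mxE /=.
by field; rewrite mun0 nun0 dn0 a1n0 a2n0.
Qed.

End Curve.

(** * Coincidence of angles *)

Section Angles.
Variable R : realType.
Implicit Types (x y om : R) (m n : nat).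

Lemma cosD2pi_nat x n : cos (x + 2 * pi * n%:R) = cos x.
Proof. by rewrite mulr_natl mulr_natr (periodicn (@cosD2pi R)). Qed.

Lemma cos_2pi_nat n : cos (2 * pi * n%:R) = 1 :> R.
Proof. by rewrite -[_ * n%:R]add0r cosD2pi_nat cos0. Qed.

Lemma cos_eq1_nat x : 0 <= x -> cos x = 1 -> exists n : nat, x = 2 * pi * n%:R.
Proof.
move=> x0 cx1; have pi0 := pi_gt0 R; have tau0 : 0 < 2 * pi :> R by lra.
have := truncn_itv (divr_ge0 x0 (ltW tau0)); set n := Num.truncn _.
rewrite ler_pdivlMr // ltr_pdivrMr // [n%:R * _]mulrC -(natr1 n).
rewrite [_ * (2 * pi)]mulrC => /andP[nx xn].
exists n; set y := x - 2 * pi * n%:R.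
have cy1 : cos y = 1.
  by rewrite -(cosD2pi_nat _ n) -[RHS]cx1; congr cos; rewrite /y; ring.
suff : y = 0 by rewrite /y => /eqP; rewrite subr_eq0 => /eqP.
have cos1_inj (z : R) : 0 <= z <= pi -> cos z = 1 -> z = 0.
  move=> zpi cz1; have : 0 <= (pi:R) by lra.
  by move=> pi0'; apply: cos_inj; rewrite ?in_itv /= ?lexx ?cz1 ?cos0.
have [ypi|piy] := leP y pi; first by apply: cos1_inj => //; rewrite ypi /y; lra.
have /cos1_inj : 0 <= 2 * pi - y <= pi by rewrite /y in piy *; apply/andP; lra.
have -> : cos (2 * pi - y) = 1.
  by rewrite -cosN -(cosD2pi_nat _ 1) -[RHS]cy1; congr cos; ring.
by move=> /(_ erefl); rewrite /y; lra.
Qed.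

Lemma cosB_eq1 x y : cos (x - y) = 1 <-> cos x = cos y /\ sin x = sin y.
Proof.
split=> [c1|[cE sE]]; last by rewrite cosB cE sE -!expr2 cos2Dsin2.
have s0 : sin (x - y) = 0 by apply: cos1sin0; rewrite c1 normr1.
have := (cosD (x - y) y, sinD (x - y) y).
by rewrite c1 s0 subrK !mul0r !mul1r subr0 add0r => -[].
Qed.

(** If x is a common period, then om n x = 2 pi j and om m x = 2 pi i, so that
    n i = m j; coprimality makes n divide j, whence j >= n. *)
Lemma common_period_ge om m n x : (0 < n)%N -> coprime m n -> 0 < om -> 0 < x ->
  cos (om * n%:R * x) = 1 -> cos (om * m%:R * x) = 1 -> 2 * pi / om <= x.
Proof.
move=> n0 mn om0 x0 cn cm; have pi0 := pi_gt0 R.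
have n0' : 0 < n%:R :> R by rewrite ltr0n.
have [|j Ej] := cos_eq1_nat _ cn; first by rewrite !mulr_ge0 ?ltW.
have [|i Ei] := cos_eq1_nat _ cm; first by rewrite !mulr_ge0 ?ler0n ?ltW.
have E : (n * i = m * j)%N.
  apply/eqP; rewrite -(eqr_nat R) !natrM; apply/eqP.
  apply: (@mulfI _ (2 * pi)); first by rewrite gt_eqF //; lra.
  by rewrite !(mulrCA (2 * pi)) -Ei -Ej; ring.
have nj : (n %| j)%N.
  by rewrite -(@Gauss_dvdr n m) 1?coprime_sym // -E dvdn_mulr.
have j0 : (0 < j)%N.
  rewrite lt0n; apply/negP => /eqP j0; move: Ej; rewrite j0 mulr0 => /eqP.
  by rewrite gt_eqF // !mulr_gt0.
rewrite ler_pdivrMr // -(ler_pM2r n0').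
have -> : x * om * n%:R = 2 * pi * j%:R by rewrite -Ej; ring.
have tau0 : 0 < 2 * pi :> R by lra.
by rewrite (ler_pM2l tau0) ler_nat dvdn_leq.
Qed.

Lemma torus_point_eq (r1 r2 x y x' y' : R) : 0 < r1 -> 0 < r2 ->
  torus_point r1 r2 x y = torus_point r1 r2 x' y' <->
  cos (x - x') = 1 /\ cos (y - y') = 1.
Proof.
move=> r10 r20; have [r1n r2n] := (lt0r_neq0 r10, lt0r_neq0 r20).
split=> [E|[/cosB_eq1[cx sx] /cosB_eq1[cy sy]]]; last first.
  by rewrite /torus_point cx sx cy sy.
have co i : torus_point r1 r2 x y i 0 = torus_point r1 r2 x' y' i 0 by rewrite E.
have := (co 0, co 1, co 2, co 3); rewrite !mxE /= => -[[[c1 c2]] c3 c4].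
split; apply/cosB_eq1; split.
- exact: (mulfI r1n).
- by apply: (mulfI r1n); apply: oppr_inj.
- exact: (mulfI r2n).
- exact: (mulfI r2n).
Qed.

End Angles.

(** * Curvatures and frequencies *)

Section Ratio.
Variable R : realType.
Implicit Types (om : R) (m n : nat).

(** Equivalently, -mu^2 and -nu^2 are the roots of s^2 + k3 s + (k3^2 - k4),
    whose product mu^2 nu^2 is k3^2 - k4. *)
Definition frequencies (k3 k4 mu nu : R) : Prop :=
  k3 = mu ^+ 2 + nu ^+ 2 /\ k4 = mu ^+ 4 + mu ^+ 2 * nu ^+ 2 + nu ^+ 4.

Lemma ratio_denominators_gt0 m n : (0 < m)%N ->
  0 < m%:R ^+ 2 + n%:R ^+ 2 :> R /\
  0 < m%:R ^+ 4 + m%:R ^+ 2 * n%:R ^+ 2 + n%:R ^+ 4 :> R.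
Proof.
move=> m0; have m0' : 0 < m%:R :> R by rewrite ltr0n.
have n0' : 0 <= n%:R :> R by rewrite ler0n.
split; first by rewrite ltr_wpDr ?sqr_ge0 ?exprn_gt0.
by rewrite !ltr_wpDr ?mulr_ge0 ?exprn_ge0 ?exprn_gt0 // ltW.
Qed.

Lemma frequencies_ratio (k3 k4 : R) om m n : (0 < m)%N ->
  frequencies k3 k4 (om * m%:R) (om * n%:R) -> curvature_ratio k3 k4 m n.
Proof.
move=> m0 [-> ->]; rewrite /curvature_ratio.
have [D1 D2] := ratio_denominators_gt0 n m0.
by field; rewrite exprMn !gt_eqF.
Qed.

(** The common unit om of the two frequencies satisfies
    k3 = om^2 (m^2 + n^2). *)
Lemma ratio_frequencies (k3 k4 : R) m n : (0 < m)%N -> 0 < k3 ->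
  curvature_ratio k3 k4 m n ->
  exists2 om, 0 < om & frequencies k3 k4 (om * m%:R) (om * n%:R).
Proof.
move=> m0 k30; rewrite /curvature_ratio.
have [D1 D2] := ratio_denominators_gt0 n m0.
set q := _ + n%:R ^+ 2 in D1 *; set p := _ + n%:R ^+ 4 in D2 * => E.
have k4E : k4 = (k3 / q) ^+ 2 * p.
  by rewrite -[LHS](divfK (lt0r_neq0 D2)) -E; field; rewrite gt_eqF.
have om0 : 0 < k3 / q by rewrite divr_gt0.
exists (Num.sqrt (k3 / q)); first by rewrite sqrtr_gt0.
have om2 : Num.sqrt (k3 / q) ^+ 2 = k3 / q by rewrite sqr_sqrtr // ltW.
split.
- by rewrite !exprMn om2 -mulrDr -/q divfK // gt_eqF.
- rewrite !exprMn -![_ ^+ 4]/(_ ^+ (2 * 2)) !exprM om2 k4E /p; ring.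
Qed.

Lemma curvature_ratioC (k3 k4 : R) m n :
  curvature_ratio k3 k4 m n -> curvature_ratio k3 k4 n m.
Proof.
rewrite /curvature_ratio [n%:R ^+ 2 + _]addrC => ->; congr (_ / _); ring.
Qed.

(** For m = n the ratio condition reads k4 = (3 / 4) k3^2. *)
Lemma curvature_ratio_neq (k3 k4 : R) m n : (0 < m)%N -> 0 < k3 -> 3 / 4 * k3 ^+ 2 < k4 ->
  curvature_ratio k3 k4 m n -> m != n.
Proof.
move=> m0 k30 k34 /(ratio_frequencies m0 k30)[om om0 [E3 E4]].
apply/negP => /eqP mn; move: k34; rewrite E3 E4 -mn.
by set x := om * _; lra.
Qed.

(** A common factor of m and n can be absorbed into the common unit om of the
    frequencies. *)
Lemma curvature_ratio_coprime (k3 k4 : R) m n : (0 < n < m)%N -> 0 < k3 ->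
  curvature_ratio k3 k4 m n ->
  exists m' n', [/\ (0 < n' < m')%N, coprime m' n' & curvature_ratio k3 k4 m' n'].
Proof.
move=> /andP[n0 nm] k30; have m0 := leq_trans n0 (ltnW nm).
move=> /(ratio_frequencies m0 k30)[om om0].
set d := gcdn m n; have d0 : (0 < d)%N by rewrite gcdn_gt0 m0.
have [m' Em] := dvdnP (dvdn_gcdl m n); have [n' En] := dvdnP (dvdn_gcdr m n).
have mn' : coprime m' n'.
  by rewrite /coprime -(eqn_pmul2r d0) mul1n muln_gcdl -Em -En.
rewrite -/d in Em En; move: n0 nm m0.
rewrite Em En !muln_gt0 d0 !andbT ltn_pmul2r // => n0 nm m0 F.
exists m', n'; split=> //; first by rewrite n0.
apply: (@frequencies_ratio _ _ (om * d%:R)) => //.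
by move: F; rewrite !natrM !mulrA ![om * _ * d%:R]mulrAC.
Qed.

End Ratio.

(** * Geometry of a curve in torus normal form *)

Section NormalForm.
Variables (R : realType) (gamma : R -> 'cV[R]_4) (A : 'M[R]_4) (a : 'cV[R]_4).
Variables (r1 r2 : R).
Hypotheses (sA : symplectic A) (r1_gt0 : 0 < r1) (r2_gt0 : 0 < r2).

Lemma torus_curve_eq (mu nu : R) :
  (forall t, A *m gamma t + a = torus_point r1 r2 (nu * t) (mu * t)) ->
  forall s t, gamma s = gamma t <->
    cos (nu * (s - t)) = 1 /\ cos (mu * (s - t)) = 1.
Proof.
move=> gammaE s t; rewrite !mulrBr -(torus_point_eq _ _ _ _ r1_gt0 r2_gt0).
rewrite -!gammaE; split=> [-> //|/addIr].
by move=> /(congr1 (mulmx (invmx A))); rewrite !mulKmx ?symplectic_unitmx.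
Qed.

Section Winding.
Variables (om : R) (m n : nat).
Hypotheses (om_gt0 : 0 < om) (n_gt0 : (0 < n)%N) (mn_coprime : coprime m n).
Hypothesis gammaE : forall t,
  A *m gamma t + a = torus_point r1 r2 (om * n%:R * t) (om * m%:R * t).

Let L := 2 * pi / om.

Let L_gt0 : 0 < L.
Proof. by rewrite divr_gt0 // mulr_gt0 ?pi_gt0. Qed.

Let omL (k : nat) : om * k%:R * L = 2 * pi * k%:R.
Proof. by rewrite /L; field; rewrite gt_eqF. Qed.

Lemma torus_curve_period : is_period gamma L.
Proof.
split=> // t; apply/(torus_curve_eq gammaE).
by rewrite addrAC subrr add0r !omL !cos_2pi_nat.
Qed.

Let eq_ge_period s t : t < s -> gamma s = gamma t -> L <= s - t.
Proof.
move=> ts /(torus_curve_eq gammaE)[cn cm].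
by apply: common_period_ge cn cm; rewrite ?subr_gt0.
Qed.

Lemma torus_curve_minimal_period : minimal_period gamma L.
Proof.
split=> [|L' [L'0 gL']]; first exact: torus_curve_period.
by have := gL' 0; rewrite add0r => /(eq_ge_period L'0); rewrite subr0.
Qed.

(* The angle is a linear function of time on both circles. *)
Let linear_winding (om' r : R) (w : int) (x y : R -> R) :
  om' * L = 2 * pi * w%:~R ->
  (forall t, x t = r * cos (om' * t) /\ y t = r * sin (om' * t)) ->
  winding x y r L w.
Proof.
move=> omLw xy; exists (fun t => om' * t); split=> //.
- by move=> t; exact: mulrl_continuous.
- by rewrite mulr0 subr0.
Qed.

Lemma torus_curve_knot : torus_knot m n gamma.
Proof.
(* The first circle is run clockwise, hence the sign of its winding number. *)
exists A, a, r1, r2, L, (- n%:Z), m%:Z => eta.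
have etaE i t : eta t i 0 =
    torus_point r1 r2 (om * n%:R * t) (om * m%:R * t) i 0.
  by rewrite /eta gammaE.
split=> //.
- split=> [t|].
    rewrite /torus /= /xcoord !etaE !mxE /= sqrrN !exprMn -!mulrDr.
    by rewrite !cos2Dsin2 !mulr1.
  split=> [|s t sL tL /addIr].
    by have [_ gL] := torus_curve_period; split=> // t; rewrite /eta gL.
  move=> /(congr1 (mulmx (invmx A))); rewrite !mulKmx ?symplectic_unitmx // => E.
  case: (ltgtP s t) => // st; [have := eq_ge_period st (esym E)|
    have := eq_ge_period st E]; move/andP: sL; move/andP: tL; lra.
- split; first by rewrite abszN.
  apply: (@linear_winding (- (om * n%:R))) => [|t].
    by rewrite mulNr omL mulrNz mulrN.
  by rewrite /= /xcoord !etaE !mxE /= mulNr cosN sinN mulrN.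
- split=> //; apply: (@linear_winding (om * m%:R)) => [|t].
    exact: omL.
  by rewrite /= /xcoord !etaE !mxE.
Qed.

End Winding.
End NormalForm.

(** * Characterization of closed curves *)

(** The discriminant 4 k4 - 3 k3^2 is (mu^2 - nu^2)^2. *)
Lemma slow_frequency (R : realType) (k3 k4 mu nu : R) : 0 < nu < mu ->
  frequencies k3 k4 mu nu ->
  Num.sqrt ((k3 - Num.sqrt (4 * k4 - 3 * k3 ^+ 2)) / 2) = nu.
Proof.
move=> /andP[nu0 numu] [-> ->].
have d0 : 0 <= mu ^+ 2 - nu ^+ 2.
  by rewrite subr_ge0 ler_pXn2r ?nnegrE ?ltW // (lt_trans nu0).
rewrite [4 * _ - _](_ : _ = (mu ^+ 2 - nu ^+ 2) ^+ 2); last by ring.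
rewrite sqrtr_sqr ger0_norm // [_ / 2](_ : _ = nu ^+ 2); last by field.
by rewrite sqrtr_sqr gtr0_norm.
Qed.

Lemma frequencies_bounds (R : realType) (k3 k4 mu nu : R) : 0 < nu < mu ->
  frequencies k3 k4 mu nu -> 0 < k3 /\ 3 / 4 * k3 ^+ 2 < k4 < k3 ^+ 2.
Proof.
move=> /andP[nu0 numu] [-> ->]; have mu0 := lt_trans nu0 numu.
have munu : 0 < mu ^+ 2 * nu ^+ 2 by rewrite mulr_gt0 ?exprn_gt0.
have d0 : 0 < (mu ^+ 2 - nu ^+ 2) ^+ 2.
  by rewrite exprn_gt0 // subr_gt0 ltr_pXn2r ?nnegrE ?ltW.
split; first by rewrite addr_gt0 ?exprn_gt0.
by apply/andP; split; lra.
Qed.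

Theorem proposition4p1 (R : realType) (gamma : R -> 'cV[R]_4) (k3 k4 : R)
    (gamma_lagrangian : lagrangian gamma)
    (gamma_arc_length : symplectic_arc_length gamma)
    (gamma_k3 : forall t : R, symplectic_curvature gamma 3 t = k3)
    (gamma_k4 : forall t : R, symplectic_curvature gamma 4 t = k4) :
  (closed_curve gamma <->
     [/\ 0 < k3,
         3 / 4 * k3 ^+ 2 < k4 < k3 ^+ 2 &
         exists m n : nat, [/\ (0 < m)%N, (0 < n)%N & curvature_ratio k3 k4 m n]])
  /\
  (closed_curve gamma ->
     (exists m n : nat,
        [/\ (0 < n < m)%N, coprime m n & curvature_ratio k3 k4 m n]) /\
     forall m n : nat,
       (0 < n < m)%N -> coprime m n -> curvature_ratio k3 k4 m n ->
       let nu := Num.sqrt ((k3 - Num.sqrt (4 * k4 - 3 * k3 ^+ 2)) / 2) in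
       [/\ torus_knot m n gamma,
           minimal_period gamma (2 * pi / (nu * m%:R) * (lcmn m n)%:R) &
           2 * pi / (nu * m%:R) * (lcmn m n)%:R = 2 * pi * n%:R / nu]).
Proof.
have [smooth lagr] := gamma_lagrangian.
have dg n t : is_derive t (1 : R) (derive1n n gamma) (derive1n n.+1 gamma t).
  exact: is_derive_derive1n.
have L12 t := (lagr t).2.
have normal mu nu : 0 < nu < mu -> frequencies k3 k4 mu nu ->
    exists (A : 'M[R]_4) (a : 'cV[R]_4) (r1 r2 : R),
      [/\ symplectic A, 0 < r1, 0 < r2 &
      forall t, A *m gamma t + a = torus_point r1 r2 (nu * t) (mu * t)].
  move=> numu [E3 E4].
  exact: (torus_normal_form dg L12 gamma_arc_length gamma_k3 gamma_k4 numu E3 E4).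
have ratio_normal m n : (0 < n < m)%N -> 0 < k3 -> curvature_ratio k3 k4 m n ->
    exists2 om, 0 < om & 0 < om * n%:R < om * m%:R /\
      frequencies k3 k4 (om * m%:R) (om * n%:R).
  move=> /andP[n0 nm] k30 /(ratio_frequencies (leq_trans n0 (ltnW nm)) k30).
  case=> om om0 F; exists om => //; split=> //.
  by rewrite mulr_gt0 ?ltr0n //= ltr_pM2l // ltr_nat.
have closed_ratio : closed_curve gamma ->
    [/\ 0 < k3, 3 / 4 * k3 ^+ 2 < k4 < k3 ^+ 2 &
     exists m n : nat, (0 < n < m)%N /\ curvature_ratio k3 k4 m n].
  move=> [L [L0 gL]].
  have [mu [nu [numu E3 E4]]] := periodic_frequencies dg L12 gamma_arc_length
    gamma_k3 gamma_k4 L0 (fun n => periodic_derive1n n gL).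
  have F : frequencies k3 k4 mu nu by [].
  have [k30 k4b] := frequencies_bounds numu F; split=> //.
  have [A [a [r1 [r2 [sA r10 r20 gE]]]]] := normal _ _ numu F.
  have [] := (torus_curve_eq sA r10 r20 gE (0 + L) 0).1 (gL 0).
  have /andP[nu0 munu] := numu; have mu0 := lt_trans nu0 munu.
  rewrite add0r subr0.
  move=> /cos_eq1_nat[|n En]; first by rewrite mulr_ge0 ?ltW.
  move=> /cos_eq1_nat[|m Em]; first by rewrite mulr_ge0 ?ltW.
  have tau0 : 0 < 2 * pi :> R by rewrite mulr_gt0 ?pi_gt0.
  have n0 : (0 < n)%N by rewrite -(ltr0n R) -(pmulr_rgt0 _ tau0) -En mulr_gt0.
  have nm : (n < m)%N.
    by rewrite -(ltr_nat R) -(ltr_pM2l tau0) -En -Em ltr_pM2r.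
  exists m, n; rewrite n0 nm; split=> //.
  apply: (@frequencies_ratio _ _ _ (2 * pi / L)); first exact: leq_trans n0 (ltnW nm).
  by rewrite ![_ / L * _]mulrAC -En -Em !mulfK ?gt_eqF.
have ratio_closed m n : (0 < n < m)%N -> 0 < k3 -> curvature_ratio k3 k4 m n ->
    closed_curve gamma.
  move=> nm k30 /(ratio_normal _ _ nm k30)[om om0 [numu F]].
  have [A [a [r1 [r2 [sA r10 r20 gE]]]]] := normal _ _ numu F.
  by exists (2 * pi / om); exact: torus_curve_period gE.
split; first split.
- move=> /closed_ratio[k30 k4b [m [n [/andP[n0 nm] ratio]]]]; split=> //.
  by exists m, n; split=> //; exact: leq_trans n0 (ltnW nm).
- move=> [k30 /andP[k4b _] [m [n [m0 n0 ratio]]]].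
  have := curvature_ratio_neq m0 k30 k4b ratio; rewrite neq_ltn => /orP[mn|nm].
  + by apply: (ratio_closed n m) (curvature_ratioC ratio); rewrite ?m0.
  + by apply: (ratio_closed m n) ratio; rewrite ?n0.
move=> /closed_ratio[k30 _ [m0 [n0 [nm0 ratio0]]]].
split=> [|m n nm mn ratio nu]; first exact: curvature_ratio_coprime nm0 k30 ratio0.
have [om om0 [numu F]] := ratio_normal m n nm k30 ratio.
have [A [a [r1 [r2 [sA r10 r20 gE]]]]] := normal _ _ numu F.
have nuE : nu = om * n%:R by exact: slow_frequency numu F.
have /andP[n_gt0 n_lt_m] := nm.
have mR0 : m%:R != 0 :> R by rewrite pnatr_eq0 -lt0n (leq_trans n_gt0) // ltnW.
have nR0 : n%:R != 0 :> R by rewrite pnatr_eq0 -lt0n.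
have lcmE : lcmn m n = (m * n)%N by rewrite -muln_lcm_gcd (eqP mn) muln1.
have LE : 2 * pi / (nu * m%:R) * (lcmn m n)%:R = 2 * pi / om.
  by rewrite lcmE nuE natrM; field; rewrite mR0 nR0 gt_eqF.
split; rewrite ?LE.
- exact: torus_curve_knot gE.
- exact: torus_curve_minimal_period gE.
- by rewrite nuE; field; rewrite nR0 gt_eqF.
Qed.
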